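(* Let $k$ be a field and $B$ a bialgebra over $k$, endowed with a $k$-linear endomorphism $\sigma\colon a\mapsto a^\sigma$ which is an algebra anti-homomorphism and a coalgebra anti-homomorphism. Suppose that $B$ is graded with finite-dimensional graded pieces, and let $B^*$ be the graded dual of $B$, a bialgebra whose product is dual to the coproduct of $B$ and whose coproduct is dual to the product of $B$. (1) The tensor product $D(B)=B\otimes B^*$ is a $k$-algebra, with associative product given by $$(a\otimes\alpha).(b\otimes\beta)=\sum a_{(2)}b_{(1)}\otimes\beta_{(2)}\alpha_{(1)}\,\langle a_{(1)}^\sigma,\beta_{(1)}\rangle\,\langle\alpha_{(2)},b_{(2)}^\sigma\rangle.$$ (2) $D(B)$ possesses a symmetric associative bilinear form $$\langle a\otimes\alpha,b\otimes\beta\rangle=\langle a^\sigma,\beta\rangle\langle\alpha,b^\sigma\rangle.$$ Therefore, if $\sigma$ is invertible, then $D(B)$ is a symmetric algebra. (3) If $B$ is cocommutative, there are algebra homomorphisms $$\Delta_l\colon D(B)\to D(B)\otimes B,\quad a\otimes\alpha\mapsto\sum a_{(1)}\otimes\alpha\otimes a_{(2)},$$ $$\Delta_r\colon D(B)\to B\otimes D(B),\quad a\otimes\alpha\mapsto\sum a_{(1)}\otimes a_{(2)}\otimes\alpha.$$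
   Context: Sweedler notation $\Delta(x)=\sum x_{(1)}\otimes x_{(2)}$ is used for comultiplication in both $B$ and $B^*$. $\langle\,,\,\rangle$ denotes the natural pairing between $B$ and $B^*$ (in either order); duality of structures means $\langle\alpha\beta,x\rangle=\sum\langle\alpha,x_{(1)}\rangle\langle\beta,x_{(2)}\rangle$ and $\langle\alpha,xy\rangle=\sum\langle\alpha_{(1)},x\rangle\langle\alpha_{(2)},y\rangle$. The grading is assumed to be such that these formulas do make the graded dual $B^*$ a bialgebra. Algebras are not required to have a unit. An algebra is symmetric, here, if it has a non-degenerate symmetric associative bilinear form (associative: $\langle xy,z\rangle=\langle x,yz\rangle$). *)

(* Defs.v *)
From HB Require Import structures.
From mathcomp Require Import all_boot all_order all_algebra.
From mathcomp Require Import boolp functions.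

Set Implicit Arguments.
Unset Strict Implicit.
Unset Printing Implicit Defensive.

Import GRing.Theory.
Local Open Scope ring_scope.
Local Open Scope quotient_scope.

Reserved Notation "x ⊗ y" (at level 40, left associativity).
Reserved Notation "⟨ alpha , x ⟩" (format "⟨ alpha ,  x ⟩").
Reserved Notation "\sw_ ( x , y <- t ) F"
  (at level 36, F at level 36, t at level 50, x name, y name,
   format "'[' \sw_ ( x ,  y  <-  t ) '/  '  F ']'").

(* [tensor U V] is the set of formal sums s of pairs (u, v), identified when
   every bilinear map takes the same value on them; [tensor_universal] below is
   its universal property. *)
Section Tensor.
Variables (k : comNzRingType) (U V : lmodType k).
Implicit Types (s : seq (U * V)).

Definition fsum_eval (W : nmodType) (f : U -> V -> W) s : W :=
  \sum_(p <- s) f p.1 p.2.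

Definition fsum_eq s t : bool :=
  `[< forall (W : lmodType k) (f : {bilinear U -> V -> W}),
        fsum_eval f s = fsum_eval f t >].

Lemma fsum_eqP s t :
  reflect (forall (W : lmodType k) (f : {bilinear U -> V -> W}),
             fsum_eval f s = fsum_eval f t) (fsum_eq s t).
Proof. exact: asboolP. Qed.

Lemma fsum_eq_equiv : equiv_class_of fsum_eq.
Proof.
split=> [s|s t|t s r].
- exact/fsum_eqP.
- by apply/fsum_eqP/fsum_eqP => H W f; rewrite H.
- by move=> /fsum_eqP H1 /fsum_eqP H2; apply/fsum_eqP => W f; rewrite H1 H2.
Qed.
Canonical fsum_eq_equivRel := EquivRelPack fsum_eq_equiv.

Definition tensor := {eq_quot fsum_eq_equivRel}.
HB.instance Definition _ : EqQuotient (seq (U * V)) fsum_eq_equivRel tensor :=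
  EqQuotient.on tensor.
HB.instance Definition _ := Choice.on tensor.

Definition tpi s : tensor := \pi_tensor s.

Lemma tpiP s t :
  tpi s = tpi t <-> forall (W : lmodType k) (f : {bilinear U -> V -> W}),
                      fsum_eval f s = fsum_eval f t.
Proof.
split=> [/eqP|H]; first by rewrite /tpi piE => /fsum_eqP.
by apply/eqP; rewrite /tpi piE; apply/fsum_eqP.
Qed.

Lemma fsum_repr (W : lmodType k) (f : {bilinear U -> V -> W}) s :
  fsum_eval f (repr (tpi s)) = fsum_eval f s.
Proof. by have /tpiP -> : tpi (repr (tpi s)) = tpi s by rewrite /tpi reprK. Qed.

Lemma tpi_repr (t : tensor) : tpi (repr t) = t.
Proof. by rewrite /tpi reprK. Qed.

Lemma fsum_cat (W : nmodType) (f : U -> V -> W) s t :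
  fsum_eval f (s ++ t) = fsum_eval f s + fsum_eval f t.
Proof. by rewrite /fsum_eval big_cat. Qed.

Definition fsum_scale (a : k) s := [seq (a *: p.1, p.2) | p <- s].

Lemma fsum_eval_scale (W : lmodType k) (f : {bilinear U -> V -> W}) a s :
  fsum_eval f (fsum_scale a s) = a *: fsum_eval f s.
Proof.
rewrite /fsum_eval big_map scaler_sumr; apply: eq_bigr => p _ /=.
by rewrite linearZl_LR.
Qed.

Definition tensor_zero : tensor := tpi [::].
Definition tensor_add (x y : tensor) : tensor := tpi (repr x ++ repr y).
Definition tensor_scale (a : k) (x : tensor) : tensor :=
  tpi (fsum_scale a (repr x)).
Definition tensor_opp (x : tensor) : tensor := tensor_scale (-1) x.

Definition fsumE := (fsum_repr, fsum_cat, fsum_eval_scale).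

Fact tensor_addA : associative tensor_add.
Proof. by move=> x y z; apply/tpiP => W f; rewrite !fsumE addrA. Qed.
Fact tensor_addC : commutative tensor_add.
Proof. by move=> x y; apply/tpiP => W f; rewrite !fsumE addrC. Qed.
Fact tensor_add0 : left_id tensor_zero tensor_add.
Proof.
move=> x; rewrite -[RHS]tpi_repr; apply/tpiP => W f.
by rewrite !fsumE {1}/fsum_eval big_nil add0r.
Qed.
Fact tensor_addN : left_inverse tensor_zero tensor_opp tensor_add.
Proof.
move=> x; apply/tpiP => W f.
by rewrite !fsumE scaleN1r addNr /fsum_eval big_nil.
Qed.
HB.instance Definition _ :=
  GRing.isZmodule.Build tensor tensor_addA tensor_addC tensor_add0 tensor_addN.

Fact tensor_scaleA a b x :
  tensor_scale a (tensor_scale b x) = tensor_scale (a * b) x.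
Proof. by apply/tpiP => W f; rewrite !fsumE scalerA. Qed.
Fact tensor_scale1 : left_id 1 tensor_scale.
Proof.
by move=> x; rewrite -[RHS]tpi_repr; apply/tpiP => W f; rewrite !fsumE scale1r.
Qed.
Fact tensor_scaleDr : right_distributive tensor_scale +%R.
Proof. by move=> a x y; apply/tpiP => W f; rewrite !fsumE scalerDr. Qed.
Fact tensor_scaleDl x : {morph tensor_scale^~ x : a b / a + b}.
Proof. by move=> a b; apply/tpiP => W f; rewrite !fsumE scalerDl. Qed.
HB.instance Definition _ := GRing.Zmodule_isLmodule.Build k tensor
  tensor_scaleA tensor_scale1 tensor_scaleDr tensor_scaleDl.

Definition tens (u : U) (v : V) : tensor := tpi [:: (u, v)].

Fact tens_bilinear :
  bilinear_for (GRing.Scale.Law.clone _ _ *:%R _)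
               (GRing.Scale.Law.clone _ _ *:%R _) tens.
Proof.
by split=> [v a u u'|u a v v']; apply/tpiP => W f;
   rewrite !fsumE /fsum_eval !big_seq1 /= ?linearPl ?linearPr.
Qed.
HB.instance Definition _ :=
  bilinear_isBilinear.Build k U V tensor _ _ tens tens_bilinear.

(* Sweedler sums: if t = \sum_i x_i ⊗ y_i, then [sweedler t f] is
   \sum_i f x_i y_i, computed on a chosen representative of t; the choice is
   irrelevant as soon as f is bilinear ([sweedlerE]). *)
Definition sweedler (W : nmodType) (t : tensor) (f : U -> V -> W) : W :=
  fsum_eval f (repr t).

Lemma tensor_sum (t : tensor) : t = \sum_(p <- repr t) tens p.1 p.2.
Proof.
rewrite -{1}[t]tpi_repr; elim: (repr t) => [|p s IHs]; first by rewrite big_nil.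
rewrite big_cons -IHs; apply/tpiP => W f.
by rewrite /tens !fsumE /fsum_eval !big_cons big_nil addr0.
Qed.

Lemma sweedlerE (W : lmodType k) (f : {bilinear U -> V -> W}) s :
  sweedler (\sum_(p <- s) tens p.1 p.2) f = \sum_(p <- s) f p.1 p.2.
Proof.
suff -> : \sum_(p <- s) tens p.1 p.2 = tpi s by rewrite /sweedler fsum_repr.
elim: s => [|p s IHs]; first by rewrite big_nil.
rewrite big_cons IHs; apply/tpiP => W' g.
by rewrite /tens !fsumE /fsum_eval !big_cons big_nil addr0.
Qed.

Lemma sweedler_tens (W : lmodType k) (f : {bilinear U -> V -> W}) u v :
  sweedler (tens u v) f = f u v.
Proof. by rewrite /sweedler /tens fsum_repr /fsum_eval big_seq1. Qed.

Lemma sweedler_linear (W : lmodType k) (f : {bilinear U -> V -> W}) :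
  linear (fun t => sweedler t f).
Proof. by move=> a x y; rewrite /sweedler !fsumE. Qed.

Lemma tensor_ext (W : lmodType k) (g h : {linear tensor -> W}) :
  (forall u v, g (tens u v) = h (tens u v)) -> g =1 h.
Proof.
by move=> gh t; rewrite [t]tensor_sum !linear_sum; apply: eq_bigr => p _.
Qed.

Lemma tensor_universal (W : lmodType k) (f : {bilinear U -> V -> W}) :
  exists2 g : {linear tensor -> W}, (forall u v, g (tens u v) = f u v)
    & forall h : {linear tensor -> W}, (forall u v, h (tens u v) = f u v) -> h =1 g.
Proof.
pose g0 t := sweedler t f.
pose gL := GRing.isLinear.Build _ _ _ _ g0 (sweedler_linear f).
pose g : {linear tensor -> W} := HB.pack g0 gL.
have gE u v : g (tens u v) = f u v by exact: sweedler_tens.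
by exists g => // h hE; apply: tensor_ext => u v; rewrite gE hE.
Qed.

End Tensor.

Notation "x ⊗ y" := (tens x y) : ring_scope.
Notation "\sw_ ( x , y <- t ) F" := (sweedler t (fun x y => F)) : ring_scope.

Section Bialgebra.
Variables (k : fieldType).

(* The componentwise product (a ⊗ b)(a' ⊗ b') = mA a a' ⊗ mB b b'. *)
Definition tensor_mul (A B : lmodType k) (mA : A -> A -> A) (mB : B -> B -> B)
    (s t : tensor A B) : tensor A B :=
  \sw_(a, b <- s) \sw_(a', b' <- t) (mA a a' ⊗ mB b b').

(* Neither a unit nor a counit is required: the notion is self-dual. *)
Record bialgebra (B : lmodType k) := Bialgebra {
  bmul : {bilinear B -> B -> B};
  bcomul : {linear B -> tensor B B};
  bmulA : associative bmul;
  bcomulA : forall x,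
    \sw_(x1, x2 <- bcomul x) \sw_(y, z <- bcomul x1) (y ⊗ z ⊗ x2) =
    \sw_(x1, x2 <- bcomul x) \sw_(y, z <- bcomul x2) (x1 ⊗ y ⊗ z);
  bcomulM : forall x y,
    bcomul (bmul x y) = tensor_mul bmul bmul (bcomul x) (bcomul y)
}.

Definition cocommutative (B : lmodType k) (S : bialgebra B) : Prop :=
  forall x, \sw_(x1, x2 <- bcomul S x) (x2 ⊗ x1) = bcomul S x.

Definition algebra_anti_hom (B : lmodType k) (S : bialgebra B)
    (f : {linear B -> B}) : Prop :=
  forall x y, f (bmul S x y) = bmul S (f y) (f x).

Definition coalgebra_anti_hom (B : lmodType k) (S : bialgebra B)
    (f : {linear B -> B}) : Prop :=
  forall x, bcomul S (f x) = \sw_(x1, x2 <- bcomul S x) (f x2 ⊗ f x1).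

Definition algebra_hom (A A' : lmodType k) (m : A -> A -> A)
    (m' : A' -> A' -> A') (f : {linear A -> A'}) : Prop :=
  forall x y, f (m x y) = m' (f x) (f y).

Definition form_symmetric (A : lmodType k) (phi : {biscalar A}) : Prop :=
  forall x y, phi x y = phi y x.

Definition form_associative (A : lmodType k) (m : A -> A -> A)
    (phi : {biscalar A}) : Prop :=
  forall x y z, phi (m x y) z = phi x (m y z).

Definition form_nondegenerate (A : lmodType k) (phi : {biscalar A}) : Prop :=
  (forall x, (forall y, phi x y = 0) -> x = 0) /\
  (forall y, (forall x, phi x y = 0) -> y = 0).

Definition symmetric_algebra (A : lmodType k) (m : A -> A -> A) : Prop :=
  exists phi : {biscalar A},
    [/\ form_nondegenerate phi, form_symmetric phi & form_associative m phi].

End Bialgebra.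

(* A grading of B by an arbitrary index type, with finite-dimensional pieces;
   no compatibility with further structure is built in. *)
Record grading (k : fieldType) (I : eqType) (B : lmodType k) := Grading {
  gpiece : I -> {pred B};
  gpiece_submod : forall i, submod_closed (gpiece i);
  gpiece_findim : forall i, exists e : seq B,
    forall x, x \in gpiece i ->
      exists c : 'I_(size e) -> k, x = \sum_j c j *: e`_j;
  gpiece_sum : forall x, exists (s : seq I) (f : I -> B),
    (forall i, f i \in gpiece i) /\ x = \sum_(i <- s) f i;
  gpiece_direct : forall (s : seq I) (f : I -> B),
    uniq s -> (forall i, f i \in gpiece i) -> \sum_(i <- s) f i = 0 ->
    forall i, i \in s -> f i = 0
}.

Section GradedDual.
Variables (k : fieldType) (I : eqType) (B : lmodType k) (G : grading I B).

(* Linear forms vanishing on all but finitely many graded pieces. *)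
Definition gdual_pred : {pred B -> k^o} :=
  [pred f : B -> k^o | `[< linear f /\
     exists s : seq I, forall i x, i \notin s -> x \in gpiece G i -> f x = 0 >]].

Lemma gdual_submod : submod_closed gdual_pred.
Proof.
split.
  apply/asboolP; split; last by exists [::].
  by move=> a x y; rewrite /= scaler0 addr0.
move=> a f g /asboolP[lf [s fs]] /asboolP[lg [t gt]]; apply/asboolP; split.
  move=> b x y /=; rewrite !fctE lf lg !scalerDr !scalerA addrACA.
  by rewrite (mulrC a b).
exists (s ++ t) => i x; rewrite mem_cat negb_or => /andP[si ti] xi.
by rewrite !fctE (fs i x) // (gt i x) // scaler0 addr0.
Qed.
HB.instance Definition _ := GRing.isSubmodClosed.Build k (B -> k^o) gdual_pred
  gdual_submod.

Record gdual := GDual { gdual_fun :> B -> k^o; _ : gdual_fun \in gdual_pred }.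
HB.instance Definition _ := [isSub for gdual_fun].
HB.instance Definition _ := [Choice of gdual by <:].
HB.instance Definition _ := [SubChoice_isSubLmodule of gdual by <:].

Lemma gdual_linear (alpha : gdual) : linear (alpha : B -> k^o).
Proof. by case: alpha => f /= /asboolP[]. Qed.
HB.instance Definition _ (alpha : gdual) :=
  GRing.isLinear.Build k B k^o _ (gdual_fun alpha) (@gdual_linear alpha).

Definition pairing (alpha : gdual) (x : B) : k := alpha x.

End GradedDual.

Notation "⟨ alpha , x ⟩" := (pairing alpha x) : ring_scope.

(* The duality between a bialgebra and a bialgebra structure on its graded
   dual. Since B and its graded dual separate each other's points, at most one
   [S'] is dual to [S]; requiring one to exist is the assumption that the two
   formulas are meaningful on the graded dual. *)
Definition dual_bialgebra (k : fieldType) (I : eqType) (B : lmodType k)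
    (G : grading I B) (S : bialgebra B) (S' : bialgebra (gdual G)) : Prop :=
  (forall (alpha beta : gdual G) (x : B),
     ⟨bmul S' alpha beta, x⟩ =
       \sw_(x1, x2 <- bcomul S x) (⟨alpha, x1⟩ * ⟨beta, x2⟩)) /\
  (forall (alpha : gdual G) (x y : B),
     ⟨alpha, bmul S x y⟩ =
       \sw_(alpha1, alpha2 <- bcomul S' alpha) (⟨alpha1, x⟩ * ⟨alpha2, y⟩)).

(* Main.v *)
(* B acts on its graded dual from both sides: lact a beta is the form
   x |-> <beta, sigma(a) x> and ract a alpha the form x |-> <alpha, x sigma(a)>.
   As sigma is an anti-homomorphism of algebras and coalgebras, lact is a left
   action, ract a right action, they commute, and both satisfy
   a.(alpha beta) = sum (a_2.alpha) (a_1.beta). In these terms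
     (a ⊗ alpha)(b ⊗ beta) = sum a_2 b_1 ⊗ lact(a_1, beta) ract(b_2, alpha),
   so that associativity and the homomorphism properties only require
   coassociativity (and cocommutativity) of B itself. The form is nondegenerate
   because graded forms separate the points of B. *)
Require Import Defs.
From HB Require Import structures.
From mathcomp Require Import all_boot all_order all_algebra.
From mathcomp Require Import boolp functions.
From mathcomp Require classical_sets.

Set Implicit Arguments.
Unset Strict Implicit.
Unset Printing Implicit Defensive.

Import GRing.Theory.
Local Open Scope ring_scope.

(** * Linearity and bilinearity as predicates on bare functions *)

Section Linearity.
Variable k : comNzRingType.
Implicit Types U V W X : lmodType k.

(** Unbundled, because the bodies of Sweedler sums are raw abstractions: the tactic [lin] proves
    these predicates by recursion on the syntax of the body. *)
Definition islin U V (f : U -> V) : Prop :=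
  forall c x y, f (c *: x + y) = c *: f x + f y.

Definition bilin U V W (f : U -> V -> W) : Prop :=
  (forall v, islin (fun u => f u v)) /\ (forall u, islin (f u)).

Lemma islinP U V (f : {linear U -> V}) : islin f.
Proof. exact: linearP. Qed.

Lemma bilinP U V W (f : {bilinear U -> V -> W}) : bilin f.
Proof. by split=> [v c x y|u c x y]; rewrite (linearPl, linearPr). Qed.

Lemma islin_linear U V (f : U -> V) :
  islin f -> exists g : {linear U -> V}, g = f :> (U -> V).
Proof.
move=> lf; pose fL := GRing.isLinear.Build _ _ _ _ f lf.
by pose g : {linear U -> V} := HB.pack f fL; exists g.
Qed.

Lemma bilin_bilinear U V W (f : U -> V -> W) :
  bilin f -> exists g : {bilinear U -> V -> W}, g = f :> (U -> V -> W).
Proof.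
case=> fl fr.
have bf : bilinear_for (GRing.Scale.Law.clone _ _ *:%R _)
                       (GRing.Scale.Law.clone _ _ *:%R _) f by split.
pose fB := bilinear_isBilinear.Build _ _ _ _ _ _ f bf.
by pose g : {bilinear U -> V -> W} := HB.pack f fB; exists g.
Qed.

Lemma islin_sum U V I (r : seq I) (P : pred I) (f : U -> V) (F : I -> U) :
  islin f -> f (\sum_(i <- r | P i) F i) = \sum_(i <- r | P i) f (F i).
Proof. by case/islin_linear=> g <-; rewrite linear_sum. Qed.

Lemma islin_scale U V (f : U -> V) c x : islin f -> f (c *: x) = c *: f x.
Proof. by case/islin_linear=> g <-; rewrite linearZ. Qed.

Lemma islin_id U : islin (fun x : U => x).
Proof. by []. Qed.

Lemma islin_comp U V W (g : V -> W) (f : U -> V) :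
  islin g -> islin f -> islin (fun x => g (f x)).
Proof. by move=> lg lf c x y; rewrite lf lg. Qed.

Lemma bilin_appl U V W X (m : U -> V -> W) (f : X -> U) v :
  bilin m -> islin f -> islin (fun x => m (f x) v).
Proof. by case=> lm _; apply: (islin_comp (lm v)). Qed.

Lemma bilin_appr U V W X (m : U -> V -> W) (f : X -> V) u :
  bilin m -> islin f -> islin (fun x => m u (f x)).
Proof. by case=> _ lm; apply: (islin_comp (lm u)). Qed.

Lemma bilin_scale V : @bilin k^o V V (fun c v => c *: v).
Proof.
by split=> [v c x y|u c x y]; rewrite ?scalerDl ?scalerDr !scalerA // mulrC.
Qed.

Lemma bilin_mul : @bilin k^o k^o k^o (fun c d => c * d).
Proof.
by split=> [v c x y|u c x y]; rewrite ?mulrDl ?mulrDr /GRing.scale /=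
  ?mulrA // (mulrC c).
Qed.

Lemma islin_sweedler U V W (f : U -> V -> W) :
  bilin f -> islin (fun t => sweedler t f).
Proof. by case/bilin_bilinear=> g <-; apply: sweedler_linear. Qed.

Lemma islin_sweedler_body U V W X t (F : X -> U -> V -> W) :
  (forall u v, islin (fun x => F x u v)) -> islin (fun x => sweedler t (F x)).
Proof.
move=> lF c x y; rewrite /sweedler /fsum_eval scaler_sumr -big_split /=.
by apply: eq_bigr => p _; apply: lF.
Qed.

End Linearity.
Arguments islin_id {k U}.

(** * Calculus of Sweedler sums *)

Section Sweedler.
Variable k : comNzRingType.
Implicit Types U V W : lmodType k.

(** Both sums run over the same chosen representative of [t], so termwise equality suffices. *)
Lemma eq_sweedler U V (W : nmodType) (t : tensor U V) (f g : U -> V -> W) :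
  (forall u v, f u v = g u v) -> sweedler t f = sweedler t g.
Proof. by move=> fg; apply: eq_bigr => p _; apply: fg. Qed.

Lemma exchange_sweedler U V U' V' (W : nmodType) (s : tensor U V)
    (t : tensor U' V') (F : U -> V -> U' -> V' -> W) :
  \sw_(u, v <- s) \sw_(u', v' <- t) F u v u' v' =
  \sw_(u', v' <- t) \sw_(u, v <- s) F u v u' v'.
Proof. exact: exchange_big. Qed.

Lemma linear_sweedler U V W W' (g : W -> W') (t : tensor U V) (f : U -> V -> W) :
  islin g -> g (\sw_(u, v <- t) f u v) = \sw_(u, v <- t) g (f u v).
Proof. exact: islin_sum. Qed.

Lemma sweedler_pure U V W (f : U -> V -> W) u v :
  bilin f -> sweedler (u ⊗ v) f = f u v.
Proof. by case/bilin_bilinear=> g <-; apply: sweedler_tens. Qed.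

(* [sweedler t f] is a junk value, dependent on the representative of t, when f
   is not bilinear: hence the side condition. *)
Lemma sweedler_sweedler U V U' V' W (t : tensor U V) (g : U -> V -> tensor U' V')
    (f : U' -> V' -> W) :
  bilin f ->
  sweedler (\sw_(u, v <- t) g u v) f = \sw_(u, v <- t) sweedler (g u v) f.
Proof. by move=> bf; rewrite (linear_sweedler _ _ (islin_sweedler bf)). Qed.

Lemma eq_on_pure_tensors U V W (g h : tensor U V -> W) :
  islin g -> islin h -> (forall u v, g (u ⊗ v) = h (u ⊗ v)) -> g =1 h.
Proof.
by move=> /islin_linear[g' <-] /islin_linear[h' <-]; apply: tensor_ext.
Qed.

End Sweedler.

(** * The pairing with the graded dual *)

Section Pairing.
Variables (k : fieldType) (I : eqType) (B : lmodType k) (G : grading I B).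
Implicit Types (alpha beta : gdual G) (x : B).

Lemma gdual_ext alpha beta :
  (forall x, ⟨alpha, x⟩ = ⟨beta, x⟩) -> alpha = beta.
Proof. by move=> E; apply/val_inj/funext. Qed.

Lemma bilin_pairing :
  @bilin k (gdual G) B k^o (@pairing k I B G).
Proof. by split=> [x|alpha] //; exact: islinP. Qed.

Lemma islin_pairingl x : @islin k (gdual G) k^o (fun alpha => ⟨alpha, x⟩).
Proof. exact: (bilin_pairing.1 x). Qed.

Lemma islin_pairingr alpha : @islin k B k^o (fun x => ⟨alpha, x⟩).
Proof. exact: (bilin_pairing.2 alpha). Qed.

End Pairing.
Arguments bilin_pairing {k I B} G.

(* Redefined below to let [lin] use facts about newly introduced operations. *)
Ltac lin_hyp := fail.

(* The head symbol is matched separately from its arguments, since a pattern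
   such as [sweedler ?t ?f] would fix the canonical structures on the codomain. *)
Ltac lin :=
  cbv beta;
  match goal with
  | |- forall _, _ => intro; lin
  | |- bilin (fun u v => _) => split; lin
  | |- bilin _ => first [exact: bilinP | lin_hyp]
  | |- @islin ?k ?X ?W ?f =>
    match f with
    | fun x => x => exact: islin_id
    | fun x => ?h ?t (@?F x) =>
      lazymatch h with
      | @sweedler _ _ _ _ => apply: (@islin_sweedler_body k _ _ W X t F); lin
      | @GRing.scale _ _ =>
        apply: (@bilin_appr k k^o W W X _ F t (@bilin_scale k W)); lin
      | @GRing.mul _ =>
        apply: (@bilin_appr k k^o k^o k^o X _ F t (@bilin_mul k)); lin
      | @pairing ?k' _ _ ?G =>
        apply: (@bilin_appr k' _ _ k'^o X _ F t (bilin_pairing G)); lin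
      | _ => apply: (@bilin_appr _ _ _ _ _ h F t); lin
      end
    | fun x => ?h (@?F x) ?t =>
      lazymatch h with
      | @sweedler _ _ _ _ =>
        apply: (@islin_comp k X _ W _ F (@islin_sweedler k _ _ W t _)); lin
      | @GRing.scale _ _ =>
        apply: (@bilin_appl k k^o W W X _ F t (@bilin_scale k W)); lin
      | @GRing.mul _ =>
        apply: (@bilin_appl k k^o k^o k^o X _ F t (@bilin_mul k)); lin
      | @pairing ?k' _ _ ?G =>
        apply: (@bilin_appl k' _ _ k'^o X _ F t (bilin_pairing G)); lin
      | _ => apply: (@bilin_appl _ _ _ _ _ h F t); lin
      end
    | fun x => ?h (@?F x) => apply: (@islin_comp _ _ _ _ h F); lin
    | ?m ?u => refine (proj2 (_ : bilin m) u); lin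
    | _ => first [exact: islinP | lin_hyp]
    end
  end.

(** * Sweedler identities in a bialgebra *)

Section BialgebraTheory.
Variables (k : fieldType) (B : lmodType k) (S : bialgebra B).
Implicit Type W : lmodType k.

Lemma sweedler_bcomulA W (f : B -> B -> B -> W) x :
  (forall y z, islin (fun x => f x y z)) ->
  (forall x z, islin (fun y => f x y z)) ->
  (forall x y, islin (fun z => f x y z)) ->
  \sw_(x1, x2 <- bcomul S x) \sw_(y, z <- bcomul S x1) f y z x2 =
  \sw_(x1, x2 <- bcomul S x) \sw_(y, z <- bcomul S x2) f x1 y z.
Proof.
move=> f1 f2 f3.
have := congr1 (fun t : tensor (tensor B B) B =>
  \sw_(p, z <- t) \sw_(x, y <- p) f x y z) (bcomulA S x).
have bf z : bilin (fun x y => f x y z) by split.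
have bh : bilin (fun p z => \sw_(x, y <- p) f x y z).
  by split=> [z|p]; [apply: islin_sweedler | apply: islin_sweedler_body].
rewrite !sweedler_sweedler //.
under eq_sweedler => x1 x2 do rewrite sweedler_sweedler //.
under [in X in _ = X -> _]eq_sweedler => x1 x2 do rewrite sweedler_sweedler //.
(* The summand is recognised as the value of the factored map on a pure tensor, the shape in which
   [E] states it. *)
move=> E; under eq_sweedler => x1 x2.
  under eq_sweedler => y z.
    rewrite (_ : f y z x2 = sweedler (y ⊗ z ⊗ x2)
       (fun p z => \sw_(x, y <- p) f x y z)); last by rewrite !sweedler_pure.
    over.
  over.
rewrite E; apply: eq_sweedler => x1 x2; apply: eq_sweedler => y z.
by rewrite !sweedler_pure.
Qed.

Lemma sweedler_bcomulM W (f : B -> B -> W) x y : bilin f ->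
  sweedler (bcomul S (bmul S x y)) f =
  \sw_(x1, x2 <- bcomul S x) \sw_(y1, y2 <- bcomul S y)
     f (bmul S x1 y1) (bmul S x2 y2).
Proof.
move=> bf; rewrite bcomulM /tensor_mul sweedler_sweedler //.
apply: eq_sweedler => x1 x2; rewrite sweedler_sweedler //.
by apply: eq_sweedler => y1 y2; rewrite sweedler_pure.
Qed.

Lemma sweedler_coalgebra_anti_hom (sigma : {linear B -> B}) W
    (f : B -> B -> W) x :
  coalgebra_anti_hom S sigma -> bilin f ->
  sweedler (bcomul S (sigma x)) f =
  \sw_(x1, x2 <- bcomul S x) f (sigma x2) (sigma x1).
Proof.
move=> cs bf; rewrite cs sweedler_sweedler //.
by apply: eq_sweedler => x1 x2; rewrite sweedler_pure.
Qed.

Lemma sweedler_cocommutative W (f : B -> B -> W) x :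
  cocommutative S -> bilin f ->
  \sw_(x1, x2 <- bcomul S x) f x1 x2 = \sw_(x1, x2 <- bcomul S x) f x2 x1.
Proof.
move=> cc bf; rewrite -[X in sweedler X _]cc sweedler_sweedler //.
by apply: eq_sweedler => x1 x2; rewrite sweedler_pure.
Qed.

(** Coassociativity regroups the sum so that the two legs to be exchanged come from a single
    coproduct, where cocommutativity applies. *)
Lemma sweedler_swap12 W (f : B -> B -> B -> W) x : cocommutative S ->
  (forall y z, islin (fun x => f x y z)) ->
  (forall x z, islin (fun y => f x y z)) ->
  (forall x y, islin (fun z => f x y z)) ->
  \sw_(x1, x2 <- bcomul S x) \sw_(y, z <- bcomul S x2) f x1 y z =
  \sw_(x1, x2 <- bcomul S x) \sw_(y, z <- bcomul S x2) f y x1 z.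
Proof.
move=> cc f1 f2 f3; rewrite -!sweedler_bcomulA //.
by apply: eq_sweedler => x1 x2; apply: (sweedler_cocommutative _ cc).
Qed.

Lemma sweedler_swap23 W (f : B -> B -> B -> W) x : cocommutative S ->
  (forall y z, islin (fun x => f x y z)) ->
  (forall x z, islin (fun y => f x y z)) ->
  (forall x y, islin (fun z => f x y z)) ->
  \sw_(x1, x2 <- bcomul S x) \sw_(y, z <- bcomul S x1) f y z x2 =
  \sw_(x1, x2 <- bcomul S x) \sw_(y, z <- bcomul S x1) f y x2 z.
Proof.
move=> cc f1 f2 f3; rewrite sweedler_bcomulA //.
rewrite (sweedler_bcomulA (f := fun x y z => f x z y)) //.
by apply: eq_sweedler => x1 x2; apply: (sweedler_cocommutative _ cc).
Qed.

End BialgebraTheory.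

(** * The componentwise product on a tensor product *)

Section TensorMul.
Variables (k : fieldType) (A A' : lmodType k).
Variables (m : A -> A -> A) (m' : A' -> A' -> A').
Hypotheses (bm : bilin m) (bm' : bilin m').

Ltac lin_hyp ::= assumption.

Lemma bilin_tensor_mul : bilin (tensor_mul m m').
Proof. rewrite /tensor_mul; lin. Qed.

Lemma tensor_mul_pure a a' b b' :
  tensor_mul m m' (a ⊗ a') (b ⊗ b') = m a b ⊗ m' a' b'.
Proof. by rewrite /tensor_mul !sweedler_pure //; lin. Qed.

End TensorMul.

(* Elimination: if some form does not vanish on the first factor of the head,
   the hypothesis expresses the second factor of the head through those of the
   tail, and the sum is rewritten with one term fewer. *)
Lemma tensor_eq0_separated (k : fieldType) (U V : lmodType k) (J : Type)
    (phi : J -> U -> k^o) (t : tensor U V) :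
  (forall j, islin (phi j)) -> (forall u, (forall j, phi j u = 0) -> u = 0) ->
  (forall j, \sw_(u, v <- t) (phi j u *: v) = 0) -> t = 0.
Proof.
move=> lphi sep.
have bphi j : bilin (fun u (v : V) => phi j u *: v).
  split=> [v|u]; last exact: (bilin_scale V).2.
  exact: (@bilin_appl k k^o V V U _ (phi j) v (@bilin_scale k V)).
rewrite /sweedler /fsum_eval => H; rewrite [t]tensor_sum; move: H.
(* Induction on a bound for the number of terms, since elimination alters the first factors of the
   tail. *)
elim: {t}(size _) {-2}(repr t) (leqnn (size (repr t))) => [|n IHn].
  by case=> // _ _; rewrite big_nil.
case=> [|[u v] l] ltn H; first by rewrite big_nil.
have [u0|/existsNP[j /eqP ju]] := pselect (forall j, phi j u = 0).
  (* Proved for every bilinear [g]: it serves with [tens] for the goal and with the contractions by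
     [phi j] for the induction hypothesis. *)
  have bil (W : lmodType k) (g : U -> V -> W) : bilin g ->
      \sum_(p <- (u, v) :: l) g p.1 p.2 = \sum_(p <- l) g p.1 p.2.
    move=> bg; rewrite big_cons /= (sep _ u0).
    by rewrite -[0](scale0r u) (islin_scale _ _ (bg.1 v)) !scale0r add0r.
  rewrite (bil _ _ (bilinP (@tens k U V))); apply: IHn => // j.
  by rewrite -(bil _ _ (bphi j)).
pose c (p : U * V) := (phi j u)^-1 * phi j p.1.
(* Once [v] is replaced by minus the sum of the [c p *: p.2], each resulting term of [u ⊗ v] is
   absorbed into the tail term with the same second factor. *)
pose l' := [seq (p.1 - c p *: u, p.2) | p <- l].
have vE : v = - \sum_(p <- l) c p *: p.2.
  apply: (scalerI ju); apply/eqP.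
  rewrite scalerN scaler_sumr -addr_eq0; apply/eqP.
  rewrite -[RHS](H j) big_cons; congr (_ + _); apply: eq_bigr => p _.
  by rewrite scalerA mulVKf.
have bil (W : lmodType k) (g : U -> V -> W) : bilin g ->
    \sum_(p <- (u, v) :: l) g p.1 p.2 = \sum_(p <- l') g p.1 p.2.
  case=> gl gr; rewrite big_cons big_map /= vE -scaleN1r.
  rewrite (islin_scale _ _ (gr u)) (islin_sum _ _ _ (gr u)).
  rewrite scaler_sumr -big_split.
  apply: eq_bigr => p _ /=; rewrite [p.1 - _]addrC -[- (c p *: u)]scaleNr gl.
  by rewrite (islin_scale _ _ (gr u)) scaleN1r scaleNr.
rewrite (bil _ _ (bilinP (@tens k U V))); apply: IHn => [|i].
  by rewrite size_map.
by rewrite -(bil _ _ (bphi i)).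
Qed.

(** * Linear forms separating a vector from a subspace *)

Section SeparatingForm.
Variables (k : fieldType) (V : lmodType k).
Implicit Type W : V -> Prop.

Definition subspace W : Prop :=
  forall c x y, W x -> W y -> W (c *: x + y).

(* By Zorn's lemma, W extends to a maximal subspace avoiding v, which is then a
   complement of the line spanned by v. *)
Lemma linear_form_separating W v : subspace W -> W 0 -> ~ W v ->
  exists phi : V -> k^o,
    [/\ islin phi, forall x, W x -> phi x = 0 & phi v != 0].
Proof.
move=> sW W0 Wv.
pose P (A : V -> Prop) :=
  [/\ subspace A, ~ A v & forall x w, A x -> W w -> A w].
have [F FP Ftot|M [[sM Mv MW] Mmax]] := @classical_sets.Zorn_bigcup V P.
  split=> [c x y [X FX Xx] [Y FY Yy]|[X FX Xv]|x w [X FX Xx] Ww].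
  - have [XY|YX] := Ftot _ _ FX FY.
      by exists Y => //; case: (FP _ FY) => sY _ _; apply: sY => //; apply: XY.
    by exists X => //; case: (FP _ FX) => sX _ _; apply: sX => //; apply: YX.
  - by case: (FP _ FX).
  - by exists X => //; case: (FP _ FX) => _ _; apply; [exact: Xx | exact: Ww].
(* An empty [M] would not be maximal, since [W] is admissible and strictly larger. *)
have M0 : M 0.
  apply: contrapT => nM0.
  have nM x : ~ M x.
    by move=> Mx; apply: nM0; rewrite -(addNr x) -scaleN1r; apply: sM.
  apply: (Mmax W); last by split.
  by split=> [x Mx|WM]; [case: (nM x) | apply/nM0/WM].
have MZ c x : M x -> M (c *: x) by move=> Mx; rewrite -[_ *: _]addr0; apply: sM.
have MD x y : M x -> M y -> M (x + y) by rewrite -{2}[x]scale1r; apply: sM.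
have dec x : exists c : k, M (x - c *: v).
  have [Mx|nMx] := pselect (M x); first by exists 0; rewrite scale0r subr0.
  (* [A] is the span of [M] and [x]. By maximality it contains [v], and the coefficient of [x] is
     nonzero because [v] is not in [M]; dividing by it gives the decomposition. *)
  pose A y := exists d : k, M (y - d *: x).
  have [d Md] : A v.
    apply: contrapT => nAv; apply: (Mmax A).
      split=> [y My|AM]; first by exists 0; rewrite scale0r subr0.
      by apply/nMx/AM; exists 1; rewrite scale1r subrr.
    split=> // [c y z [d1 M1] [d2 M2]|y w _ Ww].
      exists (c * d1 + d2).
      by rewrite scalerDl -scalerA opprD addrACA -scalerBr; apply: sM.
    by exists 0; rewrite scale0r subr0; exact: MW M0 Ww.
  have d0 : d != 0 by apply/eqP => d0; apply: Mv; rewrite d0 scale0r subr0 in Md.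
  exists d^-1; rewrite -opprB -scaleN1r -[x in _ - x](scalerK d0) -scalerBr.
  by apply/MZ/MZ.
(* Two different coefficients would put a nonzero multiple of [v] in [M]. This uniqueness makes the
   chosen coefficient linear in [x]. *)
have uniq_dec c d x : M (x - c *: v) -> M (x - d *: v) -> c = d.
  move=> Mc /(MZ (-1)) Md; apply/eqP; rewrite eq_sym -subr_eq0.
  apply/negPn/negP => dc; apply: Mv; rewrite -[v](scalerK dc); apply: MZ.
  have := MD _ _ Mc Md.
  by rewrite scaleN1r opprB addrC addrA subrK -scalerBl.
have [phi phiP] := boolp.choice dec.
exists phi; split=> [c x y|x Wx|].
- apply: (uniq_dec _ _ (c *: x + y)) => //.
  by rewrite scalerDl -scalerA opprD addrACA -scalerBr; apply: sM.
- by apply: (uniq_dec _ _ x) => //; rewrite scale0r subr0; exact: MW M0 Wx.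
- have -> : phi v = 1 by apply: (uniq_dec _ _ v) => //; rewrite scale1r subrr.
  exact: oner_neq0.
Qed.

End SeparatingForm.

(** Used to merge terms of equal degree, so that a decomposition with repeated indices becomes one
    over distinct indices, as [gpiece_direct] requires. *)
Lemma sum_by_key (A : nmodType) (I : eqType) (T : Type) (key : T -> I)
    (r : seq I) (l : seq T) (F : T -> A) :
  uniq r -> all (fun p => key p \in r) l ->
  \sum_(i <- r) \sum_(p <- l | key p == i) F p = \sum_(p <- l) F p.
Proof.
move=> ur; elim: l => [_|p l IHl /= /andP[pr lr]].
  by rewrite big_nil big1 // => i _; rewrite big_nil.
rewrite [in RHS]big_cons -IHl // [LHS](bigD1_seq (key p)) //=.
rewrite [X in _ = _ + X](bigD1_seq (key p)) //= big_cons eqxx -addrA.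
congr (_ + (_ + _)); apply: eq_bigr => i /negPf pi.
by rewrite big_cons eq_sym pi.
Qed.

(** * The graded dual separates points *)

Section GradedDualSeparates.
Variables (k : fieldType) (I : eqType) (B : lmodType k) (G : grading I B).

Lemma gpiece_sum_in i (T : eqType) (l : seq T) (P : pred T) (F : T -> B) :
  (forall p, p \in l -> P p -> F p \in gpiece G i) ->
  \sum_(p <- l | P p) F p \in gpiece G i.
Proof.
have [g0 gD] := gpiece_submod G i => Fl; rewrite big_seq_cond.
apply: (big_ind (fun x => x \in gpiece G i)) => //;
  last by move=> p /andP[]; exact: Fl.
move=> x y gx gy.
by rewrite -[x]scale1r; apply: gD.
Qed.

(** The sum of all pieces of degree other than [j]; with degree-tagged lists, addition is
    concatenation. *)
Definition other_pieces j x : Prop := exists2 l : seq (I * B),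
  (forall p, p \in l -> p.1 != j /\ p.2 \in gpiece G p.1) &
  x = \sum_(p <- l) p.2.

Lemma subspace_other_pieces j : subspace (other_pieces j).
Proof.
move=> c x y [l lP ->] [l' lP' ->].
exists ([seq (p.1, c *: p.2) | p <- l] ++ l') => [p|].
  rewrite mem_cat => /orP[/mapP[q ql ->]|]; last exact: lP'.
  have [qj qG] := lP _ ql; split=> //=.
  by have [g0 gD] := gpiece_submod G q.1; rewrite -[_ *: _]addr0; apply: gD.
by rewrite big_cat big_map scaler_sumr.
Qed.

Lemma gpiece_other_pieces j v :
  v \in gpiece G j -> other_pieces j v -> v = 0.
Proof.
move=> vj [l lP vE].
(* Placing [- v] in degree [j] and the grouped terms of [l] in the other degrees gives a vanishing
   sum of homogeneous elements, so directness kills each of them. *)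
pose f i := if i == j then - v else \sum_(p <- l | p.1 == i) p.2.
have fG i : f i \in gpiece G i.
  rewrite /f; case: eqP => [->|_].
    have [g0 gD] := gpiece_submod G j.
    by rewrite -scaleN1r -[_ *: _]addr0; apply: gD.
  by apply: gpiece_sum_in => p pl /eqP <-; case: (lP p pl).
pose r := undup [seq p.1 | p <- l].
have jr : j \notin r.
  by rewrite mem_undup; apply/mapP => -[p /lP[/eqP pj _] jp]; apply: pj.
have ur : uniq (j :: r) by rewrite /= jr undup_uniq.
have fr : \sum_(i <- j :: r) f i = 0.
  rewrite big_cons {1}/f eqxx {1}vE addrC; apply/eqP; rewrite subr_eq0; apply/eqP.
  rewrite -[RHS](@sum_by_key _ _ _ fst r); last 2 first.
  - exact: undup_uniq.
  - by apply/allP => p pl; rewrite mem_undup map_f.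
  apply: eq_big_seq => i ir; rewrite /f; case: eqP => // ij.
  by rewrite -ij ir in jr.
have := gpiece_direct ur fG fr (mem_head j r).
by rewrite /f eqxx => /eqP; rewrite oppr_eq0 => /eqP.
Qed.

(** A nonzero component [g j] of [x] is separated by a linear form from the sum of the other pieces.
    This form is supported in degree [j], hence lies in the graded dual, and takes the same value on
    [x] as on [g j]. *)
Lemma gdual_separates x : (forall alpha : gdual G, ⟨alpha, x⟩ = 0) -> x = 0.
Proof.
move=> x0; have [s [f [fG xE]]] := gpiece_sum G x.
pose g i := \sum_(i' <- s | i' == i) f i'.
have xg : x = \sum_(i <- undup s) g i.
  rewrite xE (@sum_by_key _ _ _ id) ?undup_uniq //.
  by apply/allP => i; rewrite mem_undup.
have gG i : g i \in gpiece G i.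
  by apply: gpiece_sum_in => i' _ /eqP <-.
rewrite xg big_seq big1 // => j js; apply: contrapT => gj.
have op0 : other_pieces j 0 by exists [::]; rewrite ?big_nil.
have [|phi [lphi phi0 phig]] :=
  @linear_form_separating _ _ _ (g j) (@subspace_other_pieces j) op0.
  by move/(gpiece_other_pieces (gG j)).
have phi_other i y : i != j -> y \in gpiece G i -> phi y = 0.
  move=> ij yi; apply: phi0; exists [:: (i, y)]; last by rewrite big_seq1.
  by move=> p; rewrite inE => /eqP ->.
have phiG : phi \in gdual_pred G.
  apply/asboolP; split; first exact: lphi.
  by exists [:: j] => i y; rewrite inE => ij /(phi_other _ _ ij).
have /eqP := x0 (GDual phiG); rewrite /pairing /= xg (islin_sum _ _ _ lphi).
rewrite (bigD1_seq j) ?undup_uniq //= big1 ?addr0 ?(negPf phig) // => i ij.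
exact: (phi_other i).
Qed.

End GradedDualSeparates.

(** * The two actions of B on its graded dual *)

Section Double.
Variables (k : fieldType) (B : lmodType k) (S : bialgebra B).
Variable sigma : {linear B -> B}.
Hypothesis sigma_alg : algebra_anti_hom S sigma.
Hypothesis sigma_coalg : coalgebra_anti_hom S sigma.
Variables (I : eqType) (G : grading I B) (S' : bialgebra (gdual G)).
Hypothesis S'dual : dual_bialgebra S S'.

Local Notation D := (tensor B (gdual G)).
Local Notation "x *b y" := (bmul S x y) (at level 40, left associativity).
Local Notation "x *d y" := (bmul S' x y) (at level 40, left associativity).
Implicit Types (a b c x y : B) (alpha beta gamma : gdual G) (s t : D).

(** Written through the coproduct of [beta] so that the result lies in the graded dual by
    construction; duality then recovers the form described above. *)
Definition lact a beta : gdual G :=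
  \sw_(beta1, beta2 <- bcomul S' beta) (⟨beta1, sigma a⟩ *: beta2).

Definition ract a alpha : gdual G :=
  \sw_(alpha1, alpha2 <- bcomul S' alpha) (⟨alpha2, sigma a⟩ *: alpha1).

Lemma pairing_lact a beta x : ⟨lact a beta, x⟩ = ⟨beta, sigma a *b x⟩.
Proof.
by rewrite /lact S'dual.2 (linear_sweedler _ _ (islin_pairingl x)).
Qed.

Lemma pairing_ract a alpha x : ⟨ract a alpha, x⟩ = ⟨alpha, x *b sigma a⟩.
Proof.
rewrite /ract S'dual.2 (linear_sweedler _ _ (islin_pairingl x)).
by apply: eq_sweedler => u v; rewrite mulrC.
Qed.

Lemma bilin_lact : bilin lact.
Proof.
split=> [beta|a] c x y; apply: gdual_ext => z.
  by rewrite islin_pairingl !pairing_lact linearP linearPl islin_pairingr.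
by rewrite islin_pairingl !pairing_lact islin_pairingl.
Qed.

Lemma bilin_ract : bilin ract.
Proof.
split=> [beta|a] c x y; apply: gdual_ext => z.
  by rewrite islin_pairingl !pairing_ract linearP linearPr islin_pairingr.
by rewrite islin_pairingl !pairing_ract islin_pairingl.
Qed.

Lemma lactM a b beta : lact (a *b b) beta = lact a (lact b beta).
Proof.
by apply: gdual_ext => x; rewrite !pairing_lact sigma_alg bmulA.
Qed.

Lemma ractM a b alpha : ract (a *b b) alpha = ract b (ract a alpha).
Proof.
by apply: gdual_ext => x; rewrite !pairing_ract sigma_alg bmulA.
Qed.

Lemma lact_ract a b alpha : lact a (ract b alpha) = ract b (lact a alpha).
Proof.
by apply: gdual_ext => x; rewrite !(pairing_ract, pairing_lact) bmulA.
Qed.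

Ltac lin_hyp ::= first [exact: bilin_lact | exact: bilin_ract].

(** A product of forms is evaluated on the coproduct of [sigma a *b x], which is multiplicative;
    [sigma] reverses the legs of [a], so [a2] acts on the left factor. *)
Lemma lact_mul a alpha beta :
  lact a (alpha *d beta) =
  \sw_(a1, a2 <- bcomul S a) (lact a2 alpha *d lact a1 beta).
Proof.
apply: gdual_ext => x; rewrite pairing_lact.
rewrite (linear_sweedler _ _ (islin_pairingl x)).
have bf : @bilin k B B k^o (fun x1 x2 => ⟨alpha, x1⟩ * ⟨beta, x2⟩) by lin.
rewrite S'dual.1 (sweedler_bcomulM _ _ _ bf).
rewrite (@sweedler_coalgebra_anti_hom _ _ _ _ k^o) //; last by lin.
apply: eq_sweedler => a1 a2; rewrite S'dual.1.
by apply: eq_sweedler => x1 x2; rewrite !pairing_lact.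
Qed.

Lemma ract_mul a alpha beta :
  ract a (alpha *d beta) =
  \sw_(a1, a2 <- bcomul S a) (ract a2 alpha *d ract a1 beta).
Proof.
apply: gdual_ext => x; rewrite pairing_ract.
rewrite (linear_sweedler _ _ (islin_pairingl x)).
have bf : @bilin k B B k^o (fun x1 x2 => ⟨alpha, x1⟩ * ⟨beta, x2⟩) by lin.
rewrite S'dual.1 (sweedler_bcomulM _ _ _ bf) exchange_sweedler.
rewrite (@sweedler_coalgebra_anti_hom _ _ _ _ k^o) //; last by lin.
apply: eq_sweedler => a1 a2; rewrite S'dual.1.
by apply: eq_sweedler => x1 x2; rewrite !pairing_ract.
Qed.

(** * The product of D(B) *)

Definition dmul s t : D :=
  \sw_(a, alpha <- s) \sw_(b, beta <- t)
  \sw_(a1, a2 <- bcomul S a) \sw_(b1, b2 <- bcomul S b)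
    ((a2 *b b1) ⊗ (lact a1 beta *d ract b2 alpha)).

Lemma bilin_dmul : bilin dmul.
Proof. rewrite /dmul; lin. Qed.

Lemma dmul_pure a alpha b beta :
  dmul (a ⊗ alpha) (b ⊗ beta) =
  \sw_(a1, a2 <- bcomul S a) \sw_(b1, b2 <- bcomul S b)
    ((a2 *b b1) ⊗ (lact a1 beta *d ract b2 alpha)).
Proof. by rewrite /dmul !sweedler_pure //; lin. Qed.

(** The sums hidden in the two actions are pulled out by linearity, which yields the defining
    formula with pairings. *)
Lemma dmulE a alpha b beta :
  dmul (a ⊗ alpha) (b ⊗ beta) =
  \sw_(a1, a2 <- bcomul S a) \sw_(b1, b2 <- bcomul S b)
  \sw_(alpha1, alpha2 <- bcomul S' alpha)
  \sw_(beta1, beta2 <- bcomul S' beta)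
    ((⟨beta1, sigma a1⟩ * ⟨alpha2, sigma b2⟩) *:
       ((a2 *b b1) ⊗ (beta2 *d alpha1))).
Proof.
rewrite dmul_pure; apply: eq_sweedler => a1 a2; apply: eq_sweedler => b1 b2.
have l1 : islin (fun gamma => (a2 *b b1) ⊗ (lact a1 beta *d gamma)) by lin.
rewrite {1}/ract (linear_sweedler _ _ l1); apply: eq_sweedler => alpha1 alpha2.
have l2 : islin (fun gamma =>
  (a2 *b b1) ⊗ (gamma *d (⟨alpha2, sigma b2⟩ *: alpha1))) by lin.
rewrite {1}/lact (linear_sweedler _ _ l2); apply: eq_sweedler => beta1 beta2.
have l3 : islin (fun gamma => (a2 *b b1) ⊗ (beta2 *d gamma)) by lin.
by rewrite (islin_scale _ _ l2) (islin_scale _ _ l3) scalerA.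
Qed.

Ltac lin_hyp ::= match goal with
  | |- bilin lact => exact: bilin_lact
  | |- bilin ract => exact: bilin_ract
  | |- bilin dmul => exact: bilin_dmul
  | |- _ => assumption
  end.

Lemma dmulA_pure a alpha b beta c gamma :
  dmul (a ⊗ alpha) (dmul (b ⊗ beta) (c ⊗ gamma)) =
  dmul (dmul (a ⊗ alpha) (b ⊗ beta)) (c ⊗ gamma).
Proof.
(* The common summand of both bracketings, with three legs for each element. The first bracketing
   splits [a1], [b2] and [c1] again, the second [a2], [b1] and [c2]; one use of coassociativity for
   each element relates them. *)
pose K a1 a2 a3 b1 b2 b3 c1 c2 c3 : D :=
  (a3 *b b2 *b c1) ⊗
  (lact a2 (lact b1 gamma) *d (lact a1 (ract c3 beta) *d ract c2 (ract b3 alpha))).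
transitivity (\sw_(a1, a2 <- bcomul S a) \sw_(a1', a2' <- bcomul S a1)
  \sw_(b1, b2 <- bcomul S b) \sw_(b1', b2' <- bcomul S b2)
  \sw_(c1, c2 <- bcomul S c) \sw_(c1', c2' <- bcomul S c1)
  K a1' a2' a2 b1 b1' b2' c1' c2' c2).
  have ld := bilin_dmul.2 (a ⊗ alpha).
  rewrite dmul_pure (linear_sweedler _ _ ld).
  under [RHS]eq_sweedler => a1 a2 do rewrite exchange_sweedler.
  rewrite [RHS]exchange_sweedler; apply: eq_sweedler => b1 b2.
  rewrite (linear_sweedler _ _ ld).
  under [RHS]eq_sweedler => a1 a2.
    under eq_sweedler => a1' a2' do rewrite exchange_sweedler.
    rewrite exchange_sweedler; over.
  rewrite [RHS]exchange_sweedler; apply: eq_sweedler => c1 c2.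
  rewrite dmul_pure; apply: eq_sweedler => a1 a2.
  rewrite sweedler_bcomulM; last by lin.
  rewrite [RHS]exchange_sweedler; apply: eq_sweedler => b1' b2'.
  rewrite [RHS]exchange_sweedler; apply: eq_sweedler => c1' c2'.
  have l : islin (fun delta =>
    (a2 *b (b1' *b c1')) ⊗ (delta *d ract (b2' *b c2') alpha)) by lin.
  rewrite lact_mul (linear_sweedler _ _ l); apply: eq_sweedler => a1' a2'.
  by rewrite /K ractM !bmulA.
transitivity (\sw_(a1, a2 <- bcomul S a) \sw_(a1', a2' <- bcomul S a2)
  \sw_(b1, b2 <- bcomul S b) \sw_(b1', b2' <- bcomul S b1)
  \sw_(c1, c2 <- bcomul S c) \sw_(c1', c2' <- bcomul S c2)
  K a1 a1' a2' b1' b2' b2 c1 c1' c2').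
  rewrite sweedler_bcomulA; try (rewrite /K; lin).
  apply: eq_sweedler => a1 a2; apply: eq_sweedler => a1' a2'.
  rewrite -sweedler_bcomulA; try (rewrite /K; lin).
  apply: eq_sweedler => b1 b2; apply: eq_sweedler => b1' b2'.
  rewrite sweedler_bcomulA; try (rewrite /K; lin).
  by apply: eq_sweedler => c1 c2; apply: eq_sweedler => c1' c2'.
pose ld := bilin_dmul.1 (c ⊗ gamma).
rewrite dmul_pure (linear_sweedler _ _ ld); apply: eq_sweedler => a1 a2.
rewrite (linear_sweedler _ _ ld).
rewrite exchange_sweedler; apply: eq_sweedler => b1 b2.
rewrite dmul_pure sweedler_bcomulM; last by lin.
apply: eq_sweedler => a1' a2'; apply: eq_sweedler => b1' b2'.
apply: eq_sweedler => c1 c2.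
have l : islin (fun delta =>
  (a2' *b b2' *b c1) ⊗ (lact (a1' *b b1') gamma *d delta)) by lin.
rewrite ract_mul (linear_sweedler _ _ l); apply: eq_sweedler => c1' c2'.
(* Here the right action reaches [lact a1 beta] from outside, whereas in [K] it is applied first, so
   the actions are commuted. *)
by rewrite /K lactM lact_ract.
Qed.

Lemma dmulA : associative dmul.
Proof.
move=> s t u; move: s; apply: eq_on_pure_tensors => [||a alpha]; try lin.
move: t; apply: eq_on_pure_tensors => [||b beta]; try lin.
move: u; apply: eq_on_pure_tensors => [||c gamma]; try lin.
exact: dmulA_pure.
Qed.

(** * The symmetric associative form *)

Definition dform s t : k^o :=
  \sw_(a, alpha <- s) \sw_(b, beta <- t) (⟨beta, sigma a⟩ * ⟨alpha, sigma b⟩).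

Lemma bilin_dform : bilin dform.
Proof. rewrite /dform; lin. Qed.

Lemma dform_pure a alpha b beta :
  dform (a ⊗ alpha) (b ⊗ beta) = ⟨beta, sigma a⟩ * ⟨alpha, sigma b⟩.
Proof. by rewrite /dform !(@sweedler_pure _ _ _ k^o) //; lin. Qed.

Lemma dformC s t : dform s t = dform t s.
Proof.
rewrite /dform exchange_sweedler.
apply: eq_sweedler => b beta; apply: eq_sweedler => a alpha.
exact: mulrC.
Qed.

(** Both sides are the sum of [⟨gamma, sigma b1 *b sigma a2⟩ * ⟨beta, sigma a1 *b sigma c2⟩ *
    ⟨alpha, sigma c1 *b sigma b2⟩]. *)
Lemma dform_dmul_pure a alpha b beta c gamma :
  dform (dmul (a ⊗ alpha) (b ⊗ beta)) (c ⊗ gamma) =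
  dform (a ⊗ alpha) (dmul (b ⊗ beta) (c ⊗ gamma)).
Proof.
rewrite !dmul_pure.
rewrite (linear_sweedler _ _ (bilin_dform.2 _)).
rewrite (linear_sweedler _ _ (bilin_dform.1 _)).
under eq_sweedler => a1 a2 do rewrite (linear_sweedler _ _ (bilin_dform.1 _)).
rewrite exchange_sweedler; apply: eq_sweedler => b1 b2.
rewrite (linear_sweedler _ _ (bilin_dform.2 _)).
under eq_sweedler => a1 a2.
  rewrite dform_pure S'dual.1.
  rewrite (@sweedler_coalgebra_anti_hom _ _ _ _ k^o) //; last by lin.
  have l u : @islin k k^o k^o ( *%R u) by exact: (bilin_mul _).2.
  rewrite (linear_sweedler _ _ (l _)); over.
rewrite exchange_sweedler; apply: eq_sweedler => c1 c2.
rewrite dform_pure S'dual.1.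
rewrite (@sweedler_coalgebra_anti_hom _ _ _ _ k^o) //; last by lin.
rewrite [RHS](@linear_sweedler _ _ _ k^o k^o (fun u => u * _)); last by lin.
apply: eq_sweedler => a1 a2.
by rewrite !sigma_alg !pairing_lact !pairing_ract mulrA.
Qed.

Lemma dform_dmul s t u : dform (dmul s t) u = dform s (dmul t u).
Proof.
have H := bilin_dform.
move: s; apply: eq_on_pure_tensors => [||a alpha]; try lin.
move: t; apply: eq_on_pure_tensors => [||b beta]; try lin.
move: u; apply: eq_on_pure_tensors => [||c gamma]; try lin.
exact: dform_dmul_pure.
Qed.

(** * The homomorphisms to D(B) ⊗ B and B ⊗ D(B) *)

Definition Delta_l (t : D) : tensor D B :=
  \sw_(a, alpha <- t) \sw_(a1, a2 <- bcomul S a) (a1 ⊗ alpha ⊗ a2).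

Definition Delta_r (t : D) : tensor B D :=
  \sw_(a, alpha <- t) \sw_(a1, a2 <- bcomul S a) (a1 ⊗ (a2 ⊗ alpha)).

Lemma islin_Delta_l : islin Delta_l.
Proof. rewrite /Delta_l; lin. Qed.

Lemma islin_Delta_r : islin Delta_r.
Proof. rewrite /Delta_r; lin. Qed.

Lemma Delta_l_pure a alpha :
  Delta_l (a ⊗ alpha) = \sw_(a1, a2 <- bcomul S a) (a1 ⊗ alpha ⊗ a2).
Proof. by rewrite /Delta_l sweedler_pure //; lin. Qed.

Lemma Delta_r_pure a alpha :
  Delta_r (a ⊗ alpha) = \sw_(a1, a2 <- bcomul S a) (a1 ⊗ (a2 ⊗ alpha)).
Proof. by rewrite /Delta_r sweedler_pure //; lin. Qed.

Section Cocommutative.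
Hypothesis cocomm : cocommutative S.

(** The legs of [a] match by coassociativity; for [b], the leg acting on [alpha] and the leg landing
    in B come in opposite orders on the two sides, and cocommutativity exchanges them. *)
Lemma Delta_l_dmul s t :
  Delta_l (dmul s t) = tensor_mul dmul (bmul S) (Delta_l s) (Delta_l t).
Proof.
have bm : bilin (tensor_mul dmul (bmul S)).
  by apply: bilin_tensor_mul; lin.
have ll := islin_Delta_l; have bd := bilin_dmul.
move: s; apply: eq_on_pure_tensors => [||a alpha]; try lin.
move: t; apply: eq_on_pure_tensors => [||b beta]; try lin.
pose K a1 a2 a3 b1 b2 b3 : tensor D B :=
  ((a2 *b b1) ⊗ (lact a1 beta *d ract b3 alpha)) ⊗ (a3 *b b2).
transitivity (\sw_(a1, a2 <- bcomul S a) \sw_(a1', a2' <- bcomul S a2)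
  \sw_(b1, b2 <- bcomul S b) \sw_(b1', b2' <- bcomul S b1)
    K a1 a1' a2' b1' b2' b2).
  rewrite dmul_pure (linear_sweedler _ _ ll); apply: eq_sweedler => a1 a2.
  rewrite (linear_sweedler _ _ ll) [RHS]exchange_sweedler.
  apply: eq_sweedler => b1 b2.
  by rewrite Delta_l_pure sweedler_bcomulM //; lin.
rewrite -sweedler_bcomulA; try (rewrite /K; lin).
rewrite !Delta_l_pure (linear_sweedler _ _ (bm.1 _)); apply: eq_sweedler => a1 a2.
rewrite (linear_sweedler _ _ (bm.2 _)).
under eq_sweedler => a1' a2'.
  rewrite sweedler_swap23; try (by []); try (rewrite /K; lin).
  over.
rewrite exchange_sweedler; apply: eq_sweedler => b1 b2.
have l : islin (fun d : D => d ⊗ (a2 *b b2)) by lin.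
rewrite tensor_mul_pure; try lin.
rewrite dmul_pure (linear_sweedler _ _ l).
by apply: eq_sweedler => a1' a2'; rewrite (linear_sweedler _ _ l).
Qed.

(** Now the legs of [b] match by coassociativity, and cocommutativity exchanges the leg of [a]
    acting on [beta] with the one landing in B. *)
Lemma Delta_r_dmul s t :
  Delta_r (dmul s t) = tensor_mul (bmul S) dmul (Delta_r s) (Delta_r t).
Proof.
have bm : bilin (tensor_mul (bmul S) dmul).
  by apply: bilin_tensor_mul; lin.
have ll := islin_Delta_r; have bd := bilin_dmul.
move: s; apply: eq_on_pure_tensors => [||a alpha]; try lin.
move: t; apply: eq_on_pure_tensors => [||b beta]; try lin.
pose K a1 a2 a3 b1 b2 b3 : tensor B D :=
  (a2 *b b1) ⊗ ((a3 *b b2) ⊗ (lact a1 beta *d ract b3 alpha)).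
transitivity (\sw_(a1, a2 <- bcomul S a) \sw_(a1', a2' <- bcomul S a2)
  \sw_(b1, b2 <- bcomul S b) \sw_(b1', b2' <- bcomul S b1)
    K a1 a1' a2' b1' b2' b2).
  rewrite dmul_pure (linear_sweedler _ _ ll); apply: eq_sweedler => a1 a2.
  rewrite (linear_sweedler _ _ ll) [RHS]exchange_sweedler.
  apply: eq_sweedler => b1 b2.
  by rewrite Delta_r_pure sweedler_bcomulM //; lin.
rewrite sweedler_swap12; try (by []); try (rewrite /K; lin).
rewrite !Delta_r_pure (linear_sweedler _ _ (bm.1 _)); apply: eq_sweedler => a1 a2.
rewrite (linear_sweedler _ _ (bm.2 _)).
under eq_sweedler => a1' a2'.
  rewrite sweedler_bcomulA; try (rewrite /K; lin).
  over.
rewrite exchange_sweedler; apply: eq_sweedler => b1 b2.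
have l : islin (fun d : D => (a1 *b b1) ⊗ d) by lin.
rewrite tensor_mul_pure; try lin.
rewrite dmul_pure (linear_sweedler _ _ l).
by apply: eq_sweedler => a1' a2'; rewrite (linear_sweedler _ _ l).
Qed.

End Cocommutative.

(** * Nondegeneracy of the form *)

Lemma dform_tens t b beta :
  dform t (b ⊗ beta) = \sw_(a, alpha <- t) (⟨beta, sigma a⟩ * ⟨alpha, sigma b⟩).
Proof.
by apply: eq_sweedler => a alpha; rewrite (@sweedler_pure _ _ _ k^o) //; lin.
Qed.

(** Testing against [tau x ⊗ beta] shows that contracting the first factor of [t] with [beta] after
    [sigma] gives a form vanishing at every [x]. These contractions separate the points of B because
    [sigma] is injective. *)
Lemma dform_eq0 t : bijective sigma -> (forall s, dform t s = 0) -> t = 0.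
Proof.
move=> [tau sigmaK tauK] t0.
apply: (@tensor_eq0_separated _ _ _ (gdual G) (fun beta a => ⟨beta, sigma a⟩)).
- by move=> beta; lin.
- move=> a a0; apply: (can_inj sigmaK); rewrite linear0.
  exact: gdual_separates.
move=> beta; apply: gdual_ext => x.
rewrite (linear_sweedler _ _ (islin_pairingl x)).
rewrite -[x]tauK -[RHS](t0 (tau x ⊗ beta)) dform_tens tauK.
by apply: eq_sweedler => a alpha; apply: (islin_scale _ _ (islin_pairingl x)).
Qed.

End Double.

Theorem theorem138 (k : fieldType) (B : lmodType k) (S : bialgebra B)
    (sigma : {linear B -> B})
    (sigma_alg : algebra_anti_hom S sigma)
    (sigma_coalg : coalgebra_anti_hom S sigma)
    (I : eqType) (G : grading I B)
    (S' : bialgebra (gdual G)) (S'dual : dual_bialgebra S S') :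
  let D := tensor B (gdual G) in
  exists (mul : {bilinear D -> D -> D}) (form : {biscalar D}),
  [/\ (forall (a b : B) (alpha beta : gdual G),
         mul (a ⊗ alpha) (b ⊗ beta) =
           \sw_(a1, a2 <- bcomul S a) \sw_(b1, b2 <- bcomul S b)
           \sw_(alpha1, alpha2 <- bcomul S' alpha)
           \sw_(beta1, beta2 <- bcomul S' beta)
             ((⟨beta1, sigma a1⟩ * ⟨alpha2, sigma b2⟩) *:
                (bmul S a2 b1 ⊗ bmul S' beta2 alpha1))) /\
      associative mul,
      [/\ (forall (a b : B) (alpha beta : gdual G),
             form (a ⊗ alpha) (b ⊗ beta) =
               ⟨beta, sigma a⟩ * ⟨alpha, sigma b⟩),
          form_symmetric form,
          form_associative mul form
        & bijective sigma ->
          form_nondegenerate form /\ symmetric_algebra mul]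
    & cocommutative S ->
      (exists Delta_l : {linear D -> tensor D B},
         (forall (a : B) (alpha : gdual G),
            Delta_l (a ⊗ alpha) =
              \sw_(a1, a2 <- bcomul S a) (a1 ⊗ alpha ⊗ a2)) /\
         algebra_hom mul (tensor_mul mul (bmul S)) Delta_l) /\
      (exists Delta_r : {linear D -> tensor B D},
         (forall (a : B) (alpha : gdual G),
            Delta_r (a ⊗ alpha) =
              \sw_(a1, a2 <- bcomul S a) (a1 ⊗ (a2 ⊗ alpha))) /\
         algebra_hom mul (tensor_mul (bmul S) mul) Delta_r)].
Proof.
move=> D; have [mul mulE] := bilin_bilinear (bilin_dmul sigma S'dual).
have bform := bilin_dform sigma G.
(* Scaling in [k^o] is multiplication in [k], so bilinearity into [k^o] is by conversion that of a
   scalar form. *)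
have form_bil : bilinear_for (GRing.Scale.Law.clone _ _ *%R _)
    (GRing.Scale.Law.clone _ _ *%R _) (dform sigma (G := G) : D -> D -> k).
  by split=> [t|s] ; [exact: bform.1 | exact: bform.2].
pose form : {biscalar D} := HB.pack (dform sigma (G := G) : D -> D -> k)
  (bilinear_isBilinear.Build _ _ _ _ _ _ _ form_bil).
have formE : form = dform sigma (G := G) :> (D -> D -> k) by [].
have formC : form_symmetric form by move=> s t; rewrite formE dformC.
have formA : form_associative mul form.
  by move=> s t u; rewrite mulE formE (dform_dmul sigma_alg sigma_coalg S'dual).
have formN : bijective sigma -> form_nondegenerate form.
  move=> bs; split=> t t0; apply: (dform_eq0 bs) => s; first exact: t0.
  by rewrite dformC; apply: t0.
exists mul, form; split.
- split=> [a b alpha beta|s t u]; first by rewrite mulE dmulE.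
  by rewrite mulE (dmulA sigma_alg sigma_coalg S'dual).
- split=> // [a b alpha beta|bs]; first by rewrite formE dform_pure.
  by split; [exact: formN | exists form; split=> //; apply: formN].
move=> cc; split.
  have [dl dlE] := islin_linear (@islin_Delta_l k B S I G).
  exists dl; split=> [a alpha|s t]; rewrite dlE; first exact: Delta_l_pure.
  by rewrite mulE Delta_l_dmul.
have [dr drE] := islin_linear (@islin_Delta_r k B S I G).
exists dr; split=> [a alpha|s t]; rewrite drE; first exact: Delta_r_pure.
by rewrite mulE Delta_r_dmul.
Qed.
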